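(* Let $0\le d<r$ be integers. Let $\mathcal W\subseteq\mathbb{R}^r$ be a $(d+1)$-dimensional affine-linear subspace and let $\mathcal Z\subsetneq\mathcal W$ be a quadric on $\mathcal W$. Let $t$ be a positive integer divisible by $2^d$, and let $\vec a_1,\dots,\vec a_n\in\mathbb{R}^r$ be vectors such that one can form $t$ disjoint bases of $\mathbb{R}^r$ from them. Let $(\xi_1,\dots,\xi_n)\in\{-1,1\}^n$ be independent Rademacher random variables. Then \[\Pr[\xi_1\vec a_1+\dots+\xi_n\vec a_n\in\mathcal Z]\le\frac{2^{dr+1}}{t^{(r-d)/2}}.\]
   Context: A quadratic polynomial means a polynomial of degree at most 2. For $P\in\mathbb{R}[x_1,\dots,x_d]$, $\mathrm V(P)=\{\vec x\in\mathbb{R}^d:P(\vec x)=0\}$. A quadric in $\mathbb{R}^d$ is a set $\mathrm V(P)\subsetneq\mathbb{R}^d$ for a nonzero quadratic polynomial $P$. For an affine-linear subspace $\mathcal W\subseteq\mathbb{R}^r$ of dimension $d'$, a set $\mathcal Z\subsetneq\mathcal W$ is a quadric on $\mathcal W$ if it is the image of some quadric in $\mathbb{R}^{d'}$ under an affine-linear isomorphism $\mathbb{R}^{d'}\to\mathcal W$; equivalently $\mathcal Z=\mathcal W\cap\mathrm V(P)$ for some quadratic $P\in\mathbb{R}[x_1,\dots,x_r]$ with $\mathcal W\not\subseteq\mathrm V(P)$. ''One can form $t$ disjoint bases of $\mathbb{R}^r$ from $\vec a_1,\dots,\vec a_n$'' means there are pairwise disjoint index sets $J_1,\dots,J_t\subseteq\{1,\dots,n\}$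 with each $(\vec a_j)_{j\in J_\ell}$ a basis of $\mathbb{R}^r$. A Rademacher random variable takes values $\pm1$ with probability $1/2$ each. *)

(* Defs.v *)
From mathcomp Require Import all_boot all_order all_algebra.
From mathcomp Require Import all_classical all_reals all_analysis.
(* The notations of mpoly clash with those of mathcomp-analysis. *)
From mathcomp Require Import (canonicals, coercions) mpoly.

Set Implicit Arguments.
Unset Strict Implicit.
Unset Printing Implicit Defensive.

Import Order.TTheory GRing.Theory Num.Theory.

Local Open Scope classical_set_scope.
Local Open Scope ring_scope.

Definition zero_locus (R : realType) (m : nat) (P : mpoly.mpoly m R) :
    set 'rV[R]_m :=
  [set x | mpoly.meval (fun i => x ord0 i) P = 0].

(* [mpoly.msize P] is one more than the total degree of P. *)
Definition quadric (R : realType) (m : nat) (Q : set 'rV[R]_m) : Prop :=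
  exists P : mpoly.mpoly m R,
    [/\ P != 0, (mpoly.msize P <= 3)%N, Q = zero_locus P & Q `<` setT].

Definition affine_subspace (R : realType) (r m : nat) (W : set 'rV[R]_r) :
    Prop :=
  exists (x0 : 'rV[R]_r) (U : {vspace 'rV[R]_r}),
    \dim U = m /\ W = [set x | x - x0 \in U].

Definition affine_isomorphism (R : realType) (m r : nat)
    (phi : 'rV[R]_m -> 'rV[R]_r) (W : set 'rV[R]_r) : Prop :=
  (exists (f : {linear 'rV[R]_m -> 'rV[R]_r}) (b : 'rV[R]_r),
     forall x, phi x = f x + b) /\
  set_bij setT W phi.

Definition quadric_on (R : realType) (r m : nat) (W Z : set 'rV[R]_r) : Prop :=
  Z `<` W /\
  exists (phi : 'rV[R]_m -> 'rV[R]_r) (Q : set 'rV[R]_m),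
    [/\ affine_isomorphism phi W, quadric Q & Z = phi @` Q].

(* A subfamily is listed with repetitions, so that equal vectors with
   different indices are distinct members of it. *)
Definition disjoint_bases (R : realType) (r n t : nat) (a : 'I_n -> 'rV[R]_r) :
    Prop :=
  exists J : 'I_t -> {set 'I_n},
    (forall k l : 'I_t, k != l -> J k :&: J l = finset.set0) /\
    (forall l : 'I_t, basis_of fullv [seq a j | j <- enum (J l)]).

Definition rademacher (d : measure_display) (T : measurableType d)
    (R : realType) (P : probability T R) (X : {RV P >-> R}) : Prop :=
  P [set w | X w = 1] = (2^-1)%:E /\ P [set w | X w = -1] = (2^-1)%:E.

Definition independent_RVs (d : measure_display) (T : measurableType d)
    (R : realType) (P : probability T R) (n : nat)
    (X : 'I_n -> {RV P >-> R}) : Prop :=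
  forall (J : {set 'I_n}) (B : 'I_n -> set R),
    (forall i, measurable (B i)) ->
    P [set w | forall i, i \in J -> B i (X i w)] =
    (\prod_(i in J) P (X i @^-1` B i))%E.

(* Main.v *)
From HB Require Import structures.
Require Import Defs.
From mathcomp Require Import all_boot all_order all_algebra.
From mathcomp Require Import all_classical all_reals all_analysis.
From mathcomp Require Import measurable_realfun.
From mathcomp Require Import (canonicals, coercions) mpoly.
From mathcomp Require Import ring lra zify.

(* Let X be the signed sum.

   For a coset x + U of a subspace of codimension c the probability is at most
   t^(-c/2): modulo U each basis contains c independent vectors, AM-GM lets one
   replace t (even) different families by t copies of a single one, and then
   the event factors into c independent events of the form
   "t signs sum to 0".

   Induct on d.  If the quadratic polynomial q is invariant under some
   direction of W, ignore this direction: this is why q is only assumed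
   to live on W modulo a subspace U.  If the zero set of q in W contains a
   hyperplane of W, it is contained in two hyperplanes.  Otherwise write
   X = Y + Y', each half using t/2 of the bases.  By Cauchy-Schwarz the square
   of the probability is at most Pr[Y1 + Y' in Z, Y2 + Y' in Z] with Y1, Y2
   independent copies of Y.  This forces Y1 - Y2 to be parallel to W.  If
   Y1 - Y2 is not in U, then q(y + Y1) - q(y + Y2) is a nonzero affine function
   of y, so that Y' lies in a proper quadric on a hyperplane of W - Y1, and
   the induction hypothesis applies; the case Y1 - Y2 in U is so rare that it
   is enough to use that Y' lies in W - Y1. *)

Import Order.TTheory GRing.Theory Num.Theory.

Local Open Scope ring_scope.

(** * Expectation over random signs *)

Section SignMean.
Context {R : realFieldType}.

(* The expectation of [f] at a random signed sum of the entries of [s]. *)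
Fixpoint sgmean {V : zmodType} (s : seq V) (f : V -> R) : R :=
  if s is a :: s' then
    (sgmean s' (fun x => f (a + x)) + sgmean s' (fun x => f (- a + x))) / 2
  else f 0.

Section Zmod.
Context {V : zmodType}.
Implicit Types (s : seq V) (f g : V -> R).

Lemma eq_sgmean s f g : f =1 g -> sgmean s f = sgmean s g.
Proof.
by elim: s f g => [|a s IH] f g fg //=; congr ((_ + _) / 2); apply: IH => x.
Qed.

Lemma sgmean_cst s c : sgmean s (fun=> c) = c.
Proof. by elim: s => //= a s ->; field. Qed.

Lemma sgmeanD s f g :
  sgmean s (fun x => f x + g x) = sgmean s f + sgmean s g.
Proof. by elim: s f g => //= a s IH f g; rewrite !IH; field. Qed.

Lemma sgmeanZ s c f : sgmean s (fun x => c * f x) = c * sgmean s f.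
Proof. by elim: s f => //= a s IH f; rewrite !IH; field. Qed.

Lemma le_sgmean s f g : (forall x, f x <= g x) -> sgmean s f <= sgmean s g.
Proof.
elim: s f g => //= a s IH f g fg.
by rewrite ler_pM2r // lerD // IH.
Qed.

Lemma sgmean_ge0 s f : (forall x, 0 <= f x) -> 0 <= sgmean s f.
Proof. by move=> f0; rewrite -(sgmean_cst s 0) le_sgmean. Qed.

Lemma sgmean_le s f c : (forall x, f x <= c) -> sgmean s f <= c.
Proof. by move=> fc; rewrite -[leRHS](sgmean_cst s) le_sgmean. Qed.

Lemma sgmean_cat s1 s2 f :
  sgmean (s1 ++ s2) f = sgmean s1 (fun x => sgmean s2 (fun y => f (x + y))).
Proof.
elim: s1 f => [|a s1 IH] f /=; first by apply: eq_sgmean => x; rewrite add0r.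
by rewrite !IH; congr ((_ + _) / 2); apply: eq_sgmean => x;
  apply: eq_sgmean => y; rewrite addrA.
Qed.

(** Jensen's inequality for the square: each sign contributes one instance of
    [0 <= (u - u') ^+ 2]. *)
Lemma sgmean_sqr s f : sgmean s f ^+ 2 <= sgmean s (fun x => f x ^+ 2).
Proof.
elim: s f => //= a s IH f.
have := IH (fun x => f (a + x)); have := IH (fun x => f (- a + x)).
set u := sgmean s _; set v := sgmean s _; set u' := sgmean s _.
set v' := sgmean s _ => h1 h2; have := sqr_ge0 (u - u').
rewrite !expr2 in h1 h2 *; nra.
Qed.

Lemma sgmean_opp s f : sgmean s (fun x => f (- x)) = sgmean s f.
Proof.
elim: s f => [|a s IH] f /=; first by rewrite oppr0.
rewrite addrC; congr ((_ + _) / 2); rewrite -[RHS]IH;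
  by apply: eq_sgmean => x; rewrite opprD ?opprK.
Qed.

End Zmod.

Lemma exchange_sgmean (V W : zmodType) (s1 : seq V) (s2 : seq W) F :
  sgmean s1 (fun x => sgmean s2 (F x)) =
  sgmean s2 (fun y => sgmean s1 (F^~ y)).
Proof.
elim: s1 F => //= a s1 IH F.
by rewrite !IH -sgmeanD mulrC -sgmeanZ; apply: eq_sgmean => x; rewrite mulrC.
Qed.

Lemma sgmean_map (V W : zmodType) (phi : {additive V -> W}) s f :
  sgmean (map phi s) f = sgmean s (fun x => f (phi x)).
Proof.
elim: s f => [|a s IH] f /=; first by rewrite raddf0.
by congr ((_ + _) / 2); rewrite IH; apply: eq_sgmean => x;
  rewrite raddfD ?raddfN.
Qed.

Section Perm.
Context {V : zmodType}.
Implicit Types (s : seq V) (f g : V -> R).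

Lemma perm_sgmean s1 s2 f : perm_eq s1 s2 -> sgmean s1 f = sgmean s2 f.
Proof.
(* Exchanging the two means allows a rotation, which brings the letter [a] to the front. *)
have catC s t g : sgmean (s ++ t) g = sgmean (t ++ s) g.
  rewrite !sgmean_cat exchange_sgmean; apply: eq_sgmean => x.
  by apply: eq_sgmean => y; rewrite addrC.
elim: s1 s2 f => [|a s1 IH] s2 f; first by rewrite perm_sym => /perm_nilP ->.
move=> p; have /splitPr s2a : a \in s2 by rewrite -(perm_mem p) mem_head.
case: s2a p => t1 t2 p.
have {}p : perm_eq s1 (t2 ++ t1).
  by rewrite -(perm_cons a) (perm_trans p) // perm_catC.
by rewrite catC /= !(IH _ _ p).
Qed.

(** Conditioning on the signs of [s2] only translates the argument, so a bound uniform in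
    translations survives surplus summands. *)
Lemma sgmean_cat_le s1 s2 f c :
  (forall y, sgmean s1 (fun x => f (x + y)) <= c) -> sgmean (s1 ++ s2) f <= c.
Proof. by move=> fc; rewrite sgmean_cat exchange_sgmean sgmean_le. Qed.

End Perm.
End SignMean.

(** * Repeated summands maximise concentration *)

Section Concentration.
Context {R : realFieldType} {V : zmodType}.
Implicit Types (s : seq V) (f g : V -> R).

(** The possible values of the signed sum, with repetitions; this finite support turns expectations
    into finite sums. *)
Fixpoint sgsums s : seq V :=
  if s is a :: s' then
    [seq a + x | x <- sgsums s'] ++ [seq - a + x | x <- sgsums s']
  else [:: 0].

Lemma eq_in_sgmean s f g : {in sgsums s, f =1 g} -> sgmean s f = sgmean s g.
Proof.
elim: s f g => [|a s IH] f g fg /=; first by rewrite fg ?mem_head.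
by congr ((_ + _) / 2); apply: IH => x xs; apply: fg;
  rewrite mem_cat map_f ?orbT.
Qed.

Lemma sgmean_sum (I : Type) (r : seq I) s (F : I -> V -> R) :
  sgmean s (fun x => \sum_(i <- r) F i x) = \sum_(i <- r) sgmean s (F i).
Proof.
elim: r => [|i r IH].
  by rewrite big_nil -[RHS](sgmean_cst s); apply: eq_sgmean => x; rewrite big_nil.
by rewrite big_cons -IH -sgmeanD; apply: eq_sgmean => x; rewrite big_cons.
Qed.

(** Total expectation over the values. [S] may exceed the support, so that two laws can be expanded
    over a common list. *)
Lemma sgmeanE (S : seq V) s g : uniq S -> {subset sgsums s <= S} ->
  sgmean s g = \sum_(v <- S) sgmean s (fun x => (x == v)%:R) * g v.
Proof.
move=> uS sS; under eq_bigr => v _ do rewrite mulrC -sgmeanZ.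
rewrite -sgmean_sum; apply: eq_in_sgmean => x /sS xS.
rewrite (bigD1_seq x) //= eqxx mulr1 big1 ?addr0 // => v.
by rewrite eq_sym => /negPf ->; rewrite mulr0.
Qed.

(** By symmetry the second copy may change sign, and vanishing of the sum becomes a collision of two
    independent copies. *)
Lemma sgmean_cat_self s :
  sgmean (s ++ s) (fun y => (y == 0)%:R) =
  sgmean s (fun v => sgmean s (fun x => (x == v)%:R)) :> R.
Proof.
rewrite sgmean_cat; apply: eq_sgmean => x; rewrite -sgmean_opp.
by apply: eq_sgmean => y; rewrite subr_eq0 eq_sym.
Qed.

(* Writing the left-hand side as a sum of products over the possible values
   of the first half, this is [2 * a * b <= a ^+ 2 + b ^+ 2] termwise. *)
Lemma sgmean_cat_amgm s1 s2 x :
  sgmean (s1 ++ s2) (fun y => (y == x)%:R) <=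
  (sgmean (s1 ++ s1) (fun y => (y == 0)%:R) +
   sgmean (s2 ++ s2) (fun y => (y == 0)%:R)) / 2 :> R.
Proof.
(* [S] contains all values of the first half, and [x - S] all values of the second. *)
set S := undup (sgsums s1 ++ [seq x - v | v <- sgsums s2]).
have uS : uniq S by exact: undup_uniq.
have S1 : {subset sgsums s1 <= S} by move=> v vs; rewrite mem_undup mem_cat vs.
have uS' : uniq [seq x - v | v <- S].
  by rewrite map_inj_uniq // => u v /addrI /oppr_inj.
have S2 : {subset sgsums s2 <= [seq x - v | v <- S]}.
  move=> v vs; apply/mapP; exists (x - v); last by rewrite subKr.
  by rewrite mem_undup mem_cat (map_f (fun v => x - v)) ?orbT.
pose a v : R := sgmean s1 (fun y => (y == v)%:R).
pose b v : R := sgmean s2 (fun y => (y == v)%:R).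
have -> : sgmean (s1 ++ s2) (fun y => (y == x)%:R) =
    \sum_(v <- S) a v * b (x - v).
  rewrite sgmean_cat (sgmeanE S) //; apply: eq_bigr => v _; congr (_ * _).
  by apply: eq_sgmean => y; rewrite [y == _]eq_sym subr_eq addrC [x == _]eq_sym.
rewrite !sgmean_cat_self (sgmeanE S s1) // (sgmeanE [seq x - v | v <- S] s2) //.
rewrite big_map -big_split /= mulr_suml ler_sum // => v _.
rewrite -/(a v) -/(b (x - v)).
by have := sqr_ge0 (a v - b (x - v)); rewrite expr2; nra.
Qed.

End Concentration.

(** * Maximising a functional over words *)

Section Words.
Context {T : eqType}.
Implicit Types (A s : seq T).

Fixpoint words A n : seq (seq T) :=
  if n is n'.+1 then [seq a :: w | a <- A, w <- words A n'] else [:: [::]].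

Lemma mem_words A n s : (s \in words A n) = (size s == n) && all (mem A) s.
Proof.
elim: n s => [|n IH] s /=; first by rewrite inE; case: s.
apply/allpairsP/idP => [[[a w] [/= aA]]|].
  by rewrite IH => /andP[/eqP <- wA] -> /=; rewrite eqxx wA andbT.
case: s => //= a w /andP[/eqP[wn] /andP[aA wA]].
by exists (a, w); split=> //=; rewrite IH wn eqxx.
Qed.

Lemma seq_argmax {R : realDomainType} (U : eqType) (x0 : U) (l : seq U)
    (f : U -> R) :
  x0 \in l -> exists2 x, x \in l & {in l, forall y, f y <= f x}.
Proof.
elim: l x0 => // a l IH x0 _; case: l IH => [|b l] IH.
  by exists a; rewrite ?mem_head // => y; rewrite inE => /eqP ->.
have [x xl xmax] := IH b (mem_head _ _).
have [ax|xa] := leP (f a) (f x).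
  exists x; first by rewrite inE xl orbT.
  by move=> y; rewrite inE => /predU1P[->|/xmax].
exists a; first exact: mem_head.
by move=> y; rewrite inE => /predU1P[->//|/xmax fy]; rewrite (le_trans fy) ?ltW.
Qed.

(* Among the maximisers of [M], doubling the half that is richest in a given
   letter increases the number of its occurrences until it fills the word. *)
Lemma word_max_constant {R : realFieldType} (M : seq T -> R) A m B :
  (0 < m)%N ->
  (forall s1 s2, perm_eq s1 s2 -> M s1 = M s2) ->
  (forall s1 s2, M (s1 ++ s2) <= (M (s1 ++ s1) + M (s2 ++ s2)) / 2) ->
  {in A, forall v, M (nseq (m + m) v) <= B} ->
  forall s, size s = (m + m)%N -> {subset s <= A} -> M s <= B.
Proof.
move=> m0 Mperm Mcat Mcst s sm sA.
have : s \in words A (m + m) by rewrite mem_words sm eqxx; apply/allP.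
move=> sw; have [w ww wmax] := seq_argmax _ s _ M sw.
apply: le_trans (wmax _ sw) _; move: ww; rewrite mem_words => /andP[/eqP wsz wA].
have : exists v, v \in w.
  by case: (w) wsz => [/=|v w' _]; [move: m0; case: (m)|exists v; exact: mem_head].
case=> v vw.
(* With the occurrences of [v] moved to the front, the first half is the richer one. Its double is
   still maximal: [M w] is at most the average of the two doubles, and the other double is at most
   [M w]. *)
have half u : M w <= M u -> u \in words A (m + m) ->
    exists u', [/\ size u' = m, all (mem A) u', M w <= M (u' ++ u') &
      (minn m (count_mem v u) <= count_mem v u')%N].
  move=> Mu; rewrite mem_words => /andP[/eqP usz uA].
  set u1 := [seq x <- u | pred1 v x] ++ [seq x <- u | predC (pred1 v) x].
  have pu : perm_eq u1 u by exact/permPl/perm_filterC.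
  have u1A : all (mem A) u1 by rewrite (perm_all _ pu).
  have u1sz : size u1 = (m + m)%N by rewrite (perm_size pu).
  have := u1A; rewrite -{1}(cat_take_drop m u1) all_cat => /andP[tA dA].
  have tsz : size (take m u1) = m by rewrite size_takel // u1sz leq_addr.
  have dsz : size (drop m u1) = m by rewrite size_drop u1sz addnK.
  exists (take m u1); split=> //.
    have := Mcat (take m u1) (drop m u1).
    rewrite cat_take_drop (Mperm _ _ pu) => le2.
    have : M (drop m u1 ++ drop m u1) <= M w.
      by apply: wmax; rewrite mem_words size_cat dsz eqxx all_cat dA.
    move: le2 Mu; lra.
  rewrite /u1 take_cat; case: ifP => h.
    have /all_pred1P -> : all (pred1 v) (take m [seq x <- u | pred1 v x]).
      by apply/allP => y /mem_take; rewrite mem_filter => /andP[].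
    by rewrite count_nseq /= eqxx mul1n size_takel ?leqnn ?geq_minl // ltnW.
  by rewrite count_cat count_filter (eq_count (a2 := pred1 v)) => [|x /=];
    rewrite ?andbb // (leq_trans (geq_minr _ _)) // leq_addr.
(* Doubling a half that contains [v] adds at least one occurrence, until all [m] letters are [v]. *)
have {half} climb k : exists u, [/\ size u = m, all (mem A) u,
    M w <= M (u ++ u) & (minn m k.+1 <= count_mem v u)%N].
  elim: k => [|k [u [usz uA Mu cu]]].
    have [||u [usz uA Mu cu]] := half w; rewrite ?mem_words ?wsz ?eqxx //.
    exists u; split=> //; apply: leq_trans cu.
    by move: vw; rewrite -has_pred1 has_count; lia.
  have [||u' [usz' uA' Mu' cu']] := half (u ++ u) => //.
    by rewrite mem_words size_cat usz eqxx all_cat uA.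
  by exists u'; split=> //; apply: leq_trans cu'; rewrite count_cat; lia.
have [u [usz uA Mu]] := climb m.-1.
rewrite prednK // minnn -usz => cu.
have /all_pred1P uE : all (pred1 v) u by rewrite all_count eqn_leq count_size.
apply: le_trans Mu _; rewrite uE usz -nseqD Mcst //.
exact: (allP wA).

Qed.

End Words.

(** * Point and coset probabilities *)

Section CentralBinomial.
Context {R : realFieldType}.

(** The probability that [m + m] independent fair signs sum to zero. *)
Definition central_prob m : R := 'C(m + m, m)%:R / 2 ^+ (m + m).

Lemma central_prob_ge0 m : 0 <= central_prob m.
Proof. by rewrite divr_ge0 // exprn_ge0. Qed.

Lemma central_probS m :
  central_prob m.+1 = central_prob m * ((m + m).+1%:R / (m + m).+2%:R).
Proof.
have e1 := mul_bin_diag (m + m).+2 m; have e2 := mul_bin_down (m + m).+1 m.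
rewrite -[(m + m).+2.-1]/(m + m).+1 in e1.
rewrite -[(m + m).+1.-1]/(m + m)%N subSn ?leq_addr // addnK in e2.
have := congr1 (fun k => k%:R : R) e1; have := congr1 (fun k => k%:R : R) e2.
rewrite /central_prob addSn addnS !natrM !exprS.
set x := 'C((m + m).+2, m.+1)%:R; set y := 'C((m + m).+1, m)%:R.
set z := 'C(m + m, m)%:R.
have -> : (m + m).+2%:R = 2 * m.+1%:R :> R by rewrite -natrM; congr _%:R; lia.
have m0 : m.+1%:R != 0 :> R by rewrite pnatr_eq0.
move=> h2 h1; have -> : x = 2 * y.
  by apply: (mulfI m0); rewrite -h1; ring.
have -> : y = (m + m).+1%:R * z / m.+1%:R by rewrite h2; field.
have : 2 ^+ (m + m) != 0 :> R by rewrite expf_neq0.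
by move=> ?; field; apply/andP.
Qed.

(** The left side is 1 at [m = 0] and does not increase, as (2m+1)(2m+3) <= (2m+2)^2. The factor
    2m+1 instead of 2m later covers an odd number of bases. *)
Lemma central_prob_sqr m : central_prob m ^+ 2 * (m + m).+1%:R <= 1.
Proof.
elim: m => [|m IH]; first by rewrite /central_prob bin0 !expr0 divr1 expr1n mulr1.
rewrite central_probS addSn addnS; apply: le_trans IH.
rewrite exprMn -mulrA; apply: ler_wpM2l; first exact: sqr_ge0.
rewrite expr_div_n mulrAC ler_pdivrMr ?exprn_gt0 // expr2 -mulrA.
by apply: ler_wpM2l => //; rewrite -natrM -natrX ler_nat; lia.
Qed.

End CentralBinomial.

(** * Concentration for linearly independent families *)

Section Free.
Context {R : realFieldType}.

(** The index [i] counts the plus signs; the coefficient 2i - n of [f] is written as a difference of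
    natural multiples. *)
Lemma sgmean_nseq (V : zmodType) (f : V) n (g : V -> R) :
  sgmean (nseq n f) g =
  (\sum_(i < n.+1) 'C(n, i)%:R * g (f *+ i.*2 - f *+ n)) / 2 ^+ n.
Proof.
pose T n (G : nat -> R) := \sum_(i < n.+1) 'C(n, i)%:R * G i.
have pascal k G : T k.+1 G = T k (fun i => G i.+1) + T k G.
  have -> : T k G = \sum_(i < k.+2) 'C(k, i)%:R * G i.
    by rewrite big_ord_recr /= bin_small // mul0r addr0.
  rewrite /T big_ord_recl [X in _ = _ + X]big_ord_recl /= !bin0 [RHS]addrCA.
  congr (_ + _).
  rewrite -big_split /=; apply: eq_bigr => i _.
  by rewrite /bump /= !add1n binS natrD mulrDl addrC.
rewrite -[X in X / _]/(T n (fun i => g (f *+ i.*2 - f *+ n))).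
elim: n g => [|n IH] g /=.
  by rewrite /T big_ord_recl big_ord0 addr0 subrr bin0 mul1r expr0 divr1.
rewrite !IH -mulrDl -mulrA exprSr -invfM pascal; congr ((_ + _) / _);
  apply: eq_bigr => i _; congr (_ * g _).
  by rewrite doubleS !mulrS opprD addrACA subrr add0r addrA.
by rewrite mulrS opprD addrCA.
Qed.

Context {V : vectType R}.
Implicit Types (s F : seq V) (U : {vspace V}).

Lemma sgmean_nseq_eq0 (f : V) m : f != 0 ->
  sgmean (nseq (m + m) f) (fun y => (y == 0)%:R) = central_prob m :> R.
Proof.
move=> f0; rewrite sgmean_nseq /central_prob; congr (_ / _).
have mlt : (m < (m + m).+1)%N by rewrite ltnS leq_addr.
rewrite (bigD1 (Ordinal mlt)) //= -addnn subrr eqxx mulr1 big1 ?addr0 // => i.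
rewrite -val_eqE /= => im; rewrite subr_eq0 -!scaler_nat -subr_eq0 -scalerBl.
rewrite scaler_eq0 (negPf f0) orbF subr_eq0 eqr_nat.
by rewrite (_ : _ == _ = false) ?mulr0 //; move: im; lia.
Qed.

(** Zero is a likeliest value: the AM-GM bound for two equal halves compares any [x] with 0. *)
Lemma sgmean_nseq_le (f x : V) m : f != 0 ->
  sgmean (nseq (m + m) f) (fun y => (y == x)%:R) <= central_prob m :> R.
Proof.
move=> f0; rewrite nseqD (le_trans (sgmean_cat_amgm _ _ _)) //.
by rewrite -nseqD sgmean_nseq_eq0 //; lra.
Qed.

Lemma sgsums_memv s U : {subset s <= U} -> {subset sgsums s <= U}.
Proof.
elim: s => [|a s IH] sU x /=; first by rewrite inE => /eqP ->; exact: mem0v.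
have aU : a \in U by rewrite sU ?mem_head.
have {}IH : {subset sgsums s <= U}.
  by apply: IH => y ys; apply: sU; rewrite inE ys orbT.
by rewrite mem_cat => /orP[] /mapP[y /IH yU ->]; rewrite memvD ?memvN.
Qed.

Lemma perm_flatten_nseq_cons (f : V) F N :
  perm_eq (flatten (nseq N (f :: F))) (nseq N f ++ flatten (nseq N F)).
Proof.
elim: N => //= N IH; rewrite perm_cons perm_sym.
by rewrite perm_catCA perm_cat2l perm_sym.
Qed.

(** Group the copies of the first vector [f]. As [f] is independent of the rest, [x] determines the
    multiple of [f]; one factor [central_prob m] splits off, and the rest is the same problem with a
    translated target. *)
Lemma sgmean_flatten_nseq_le F x m : free F ->
  sgmean (flatten (nseq (m + m) F)) (fun y => (y == x)%:R) <=
  central_prob m ^+ size F :> R.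
Proof.
elim: F x => [|f F IH] x; first by rewrite expr0 sgmean_le // => y; case: eqP.
rewrite free_cons => /andP[fF freeF].
have f0 : f != 0 by apply: contraNneq fF => ->; exact: mem0v.
rewrite (perm_sgmean _ _ _ (perm_flatten_nseq_cons _ _ _)) sgmean_cat.
set s := nseq _ f; set t := flatten _.
have sf : {subset sgsums s <= <[f]>%VS}.
  by apply: sgsums_memv => y /nseqP[-> _]; exact: memv_line.
have tF : {subset sgsums t <= <<F>>%VS}.
  apply: sgsums_memv => y /flattenP[l /nseqP[-> _]]; exact: memv_span.
(* The only multiple of [f] compatible with [x]; if there is none, 0 is an arbitrary default. *)
have [y0 y0P] : exists y0, forall y, y \in <[f]>%VS -> x - y \in <<F>>%VS -> y = y0.
  have [[y0 y0f y0F]|nex] := pselect (exists2 y, y \in <[f]>%VS & x - y \in <<F>>%VS).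
    exists y0 => y /vlineP[k yk] yF; move: y0f => /vlineP[k0 y0k].
    apply/eqP; rewrite -subr_eq0 yk y0k -scalerBl scaler_eq0 subr_eq0.
    have : (k - k0) *: f \in <<F>>%VS.
      by rewrite scalerBl -yk -y0k -(subrKA x) addrC -[y - x]opprB memvB.
    by rewrite rpredZeq (negPf fF) orbF subr_eq0 => ->.
  by exists 0 => y yf yF; case: nex; exists y.
rewrite exprS; apply: le_trans (_ : sgmean s
    (fun y => central_prob m ^+ size F * (y == y0)%:R) <= _); last first.
  rewrite sgmeanZ mulrC ler_wpM2r ?exprn_ge0 ?central_prob_ge0 //.
  exact: sgmean_nseq_le.
rewrite (eq_in_sgmean s _
    (fun y => sgmean t (fun z => (y + z == x)%:R) * (y == y0)%:R)).
  apply: le_sgmean => y; apply: ler_wpM2r => //.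
  rewrite (eq_sgmean _ _ (fun z => (z == x - y)%:R)) ?IH // => z.
  by rewrite [z == _]eq_sym subr_eq addrC [x == _]eq_sym.
move=> y /sf yf; have [->|yy0] := eqVneq y y0; first by rewrite mulr1.
rewrite mulr0 -[RHS](sgmean_cst t); apply: eq_in_sgmean => z /tF zF.
case: eqP => // xyz; move: yy0; rewrite (y0P y) ?eqxx //.
by rewrite -xyz addrAC subrr add0r.
Qed.

(** For target 0, maximising over words whose letters are whole families reduces to repetitions of
    one family. A general target is first replaced by 0 by doubling the two halves. *)
Lemma sgmean_flatten_le (Fs : seq (seq V)) c x m :
  size Fs = (m + m)%N -> {in Fs, forall F, free F && (size F == c)} ->
  sgmean (flatten Fs) (fun y => (y == x)%:R) <= central_prob m ^+ c :> R.
Proof.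
case: m => [|m] Fsz Fsc.
  rewrite /central_prob bin0 expr0 divr1 expr1n.
  by rewrite sgmean_le // => y; case: eqP.
pose M (s : seq (seq V)) : R := sgmean (flatten s) (fun y => (y == 0)%:R).
have Mle (s : seq (seq V)) : size s = (m.+1 + m.+1)%N ->
    (forall F, F \in s -> F \in Fs) -> M s <= central_prob m.+1 ^+ c.
  apply: word_max_constant => // [s1 s2 p|s1 s2|F /Fsc /andP[freeF /eqP <-]].
  - exact/perm_sgmean/perm_flatten.
  - by rewrite /M !flatten_cat sgmean_cat_amgm.
  - exact: sgmean_flatten_nseq_le.
rewrite -(cat_take_drop m.+1 Fs) flatten_cat.
apply: le_trans (sgmean_cat_amgm _ _ _) _; rewrite -!flatten_cat.
set s1 := take _ _; set s2 := drop _ _.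
have : M (s1 ++ s1) <= central_prob m.+1 ^+ c.
  apply: Mle => [|F]; last by rewrite mem_cat orbb => /mem_take.
  by rewrite size_cat size_takel // Fsz leq_addr.
have : M (s2 ++ s2) <= central_prob m.+1 ^+ c.
  apply: Mle => [|F]; last by rewrite mem_cat orbb => /mem_drop.
  by rewrite size_cat size_drop Fsz addnK.
by rewrite /M; lra.
Qed.

End Free.

(** * Concentration on cosets of a subspace *)

Section Coset.
Context {R : rcfType} {V : vectType R}.
Implicit Types (s F : seq V) (U : {vspace V}).

Lemma perm_free_span s : exists F s',
  [/\ perm_eq s (F ++ s'), free F & span F = span s].
Proof.
elim: s => [|a s [F [s' [p freeF FE]]]].
  by exists [::], [::]; rewrite nil_free.
have [aF|aF] := boolP (a \in <<F>>%VS).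
  exists F, (a :: s'); split=> //.
    by rewrite perm_sym perm_catC /= perm_cons perm_catC perm_sym.
  rewrite FE span_cons; apply/esym/addv_idPr; rewrite -FE.
  by rewrite -memvE.
exists (a :: F), s'; rewrite /= perm_cons free_cons aF !span_cons FE.
by split.
Qed.

(** The vectors left over are kept in [s']: their signs stay in the sum and are conditioned on
    later. *)
Lemma perm_flatten_free (Ls : seq (seq V)) c :
  {in Ls, forall L, \dim <<L>> = c} -> exists Fs s',
  [/\ perm_eq (flatten Ls) (flatten Fs ++ s'), size Fs = size Ls &
      {in Fs, forall F, free F && (size F == c)}].
Proof.
elim: Ls => [|L Ls IH] Lc; first by exists [::], [::].
have [|Fs [s' [p sz Fsc]]] := IH.
  by move=> L' L'Ls; apply: Lc; rewrite inE L'Ls orbT.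
have [F [s'' [q freeF FE]]] := perm_free_span L.
exists (F :: Fs), (s'' ++ s'); split => /=; last 2 first.
- by rewrite sz.
- move=> F'; rewrite inE => /predU1P[->|/Fsc //].
  by rewrite freeF -(Lc L) ?mem_head // -FE eq_sym.
apply: perm_trans (perm_cat q p) _.
by rewrite -!catA perm_cat2l perm_catCA.
Qed.

Lemma sgmean_coset_le (Bs : seq (seq V)) U x :
  {in Bs, forall B, basis_of fullv B} ->
  sgmean (flatten Bs) (fun y => (y - x \in U)%:R) *
    Num.sqrt (size Bs)%:R ^+ (dim V - \dim U) <= 1 :> R.
Proof.
move=> Bbasis; set t := size Bs; set c := (_ - _)%N.
(* [pi] models the quotient by [U]: the coset event becomes a point event, and the image of each
   basis spans a space of dimension [c]. *)
pose pi := (\1 - projv U)%VF.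
have kerpi : lker pi = U.
  apply/vspaceP => y; rewrite memv_ker add_lfunE opp_lfunE id_lfunE subr_eq0.
  by apply/eqP/idP => [->|/projv_id -> //]; exact: memv_proj.
have piE y : (y - x \in U) = (pi y == pi x).
  by rewrite -[in LHS]kerpi memv_ker linearB subr_eq0.
pose Ls := [seq [seq pi b | b <- B] | B <- Bs].
have Lc : {in Ls, forall L, \dim <<L>> = c}.
  move=> _ /mapP[B BBs ->]; rewrite -limg_span (span_basis (Bbasis B BBs)).
  have := limg_ker_dim pi fullv; rewrite capfv kerpi dimvf /c => <-.
  by rewrite addKn.
have -> : sgmean (flatten Bs) (fun y => (y - x \in U)%:R) =
    sgmean (flatten Ls) (fun y => (y == pi x)%:R) :> R.
  rewrite -map_flatten sgmean_map; apply: eq_sgmean => y; by rewrite piE.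
have [Fs [s' [p sz Fsc]]] := perm_flatten_free _ _ Lc.
rewrite (perm_sgmean _ _ _ p).
(* An even number of families is needed; if [t] is odd, one of them joins the conditioned
   vectors. *)
set m := t./2; set Fs1 := take (m + m) Fs; set s1 := flatten (drop (m + m) Fs) ++ s'.
have t2 : (m + m <= t)%N by rewrite addnn -[leqRHS]odd_double_half leq_addl.
have -> : flatten Fs ++ s' = flatten Fs1 ++ s1.
  by rewrite catA -flatten_cat cat_take_drop.
have bound : sgmean (flatten Fs1 ++ s1) (fun y => (y == pi x)%:R) <=
    central_prob m ^+ c :> R.
  apply: sgmean_cat_le => y.
  rewrite (eq_sgmean _ _ (fun z => (z == pi x - y)%:R)); last first.
    by move=> z; rewrite [z == _]eq_sym subr_eq eq_sym.
  apply: sgmean_flatten_le => [|F /mem_take /Fsc //].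
  by rewrite size_takel // sz size_map.
have t0 : 0 <= Num.sqrt t%:R ^+ c :> R by rewrite exprn_ge0 ?sqrtr_ge0.
apply: le_trans (ler_wpM2r t0 bound) _; rewrite -exprMn.
apply: exprn_ile1; first by rewrite mulr_ge0 ?central_prob_ge0 ?sqrtr_ge0.
rewrite -(@ler_pXn2r _ 2) ?nnegrE ?mulr_ge0 ?central_prob_ge0 ?sqrtr_ge0 //.
rewrite expr1n exprMn sqr_sqrtr ?ler0n //.
(* Both parities of [t] satisfy [t <= (m + m).+1]. *)
apply: le_trans (central_prob_sqr m); apply: ler_wpM2l; first exact: sqr_ge0.
by rewrite ler_nat; move: (odd_double_half t); rewrite -/m; lia.
Qed.

End Coset.

(** * Quadratic functions *)

Section Quadratic.
Context {R : rcfType} {V : vectType R}.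
Implicit Types (q : V -> R) (U W : {vspace V}) (L : 'Hom(V, R^o)).

Lemma linear_form_hom (f : V -> R) :
  (forall k x y, f (k *: x + y) = k * f x + f y) ->
  exists L, forall x, L x = f x.
Proof.
move=> flin; pose fl : {linear V -> R^o} :=
  HB.pack (f : V -> R^o) (GRing.isLinear.Build R V R^o *:%R f flin).
by exists (linfun fl) => x; rewrite lfunE.
Qed.

Lemma dim_cap_lker_form W L w :
  w \in W -> L w != 0 -> (\dim (W :&: lker L)).+1 = \dim W.
Proof.
move=> wW Lw; rewrite -(limg_ker_dim L W) -addn1; congr (_ + _)%N.
apply/esym/eqP; rewrite eqn_leq; apply/andP; split.
  by apply: leq_trans (dimvS (subvf _)) _; rewrite dimvf.
rewrite lt0n dimv_eq0; apply: contraNneq Lw => LW0.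
by rewrite -memv0 -LW0 memv_img.
Qed.

(** A vector [w] of [W] outside [U] has a nonzero component modulo [U]; a nonzero coordinate of it
    provides [L], and a dimension count gives equality. *)
Lemma hyperplane_form U W : (U <= W)%VS -> \dim W = (\dim U).+1 ->
  exists L w, [/\ w \in W, L w != 0 & (W :&: lker L)%VS = U].
Proof.
move=> UW dimW.
have /subvPn[w wW wU] : ~~ (W <= U)%VS.
  by apply/negP => /dimvS; rewrite dimW ltnn.
pose pw := w - projv U w.
have pw0 : pw != 0.
  by rewrite subr_eq0; apply: contraNneq wU => ->; exact: memv_proj.
have /existsP[i pwi] : [exists i, coord (vbasis fullv) i pw != 0].
  apply: contraNT pw0; rewrite negb_exists => /forallP pw0.
  rewrite (coord_vbasis (memvf pw)) big1 // => i _.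
  by have := pw0 i; rewrite negbK => /eqP ->; rewrite scale0r.
have [k x y|L LE] := @linear_form_hom
    (fun v => coord (vbasis fullv) i (v - projv U v)).
  rewrite linearP opprD addrACA -scalerBr.
  by rewrite linearP.
have Lw : L w != 0 by rewrite LE.
exists L, w; split=> //; apply/esym/eqP; rewrite eqEdim subv_cap UW /=.
apply/andP; split.
  by apply/subvP => u uU; rewrite memv_ker LE projv_id // subrr linear0.
by rewrite -ltnS (dim_cap_lker_form _ _ _ wW Lw) dimW.
Qed.

(* [B x y] is half of the second difference of [q], so that [q] is a
   polynomial function of degree at most 2. *)
Definition quadratic_fun q := exists (B : V -> 'Hom(V, R^o)) L,
  (forall x y, B x y = B y x) /\
  forall x y, q (x + y) = q x + (2 * B x y + B y y + L y).

Lemma quadratic_fun_shift q z :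
  quadratic_fun q -> quadratic_fun (fun x => q (x + z)).
Proof.
move=> [B [L [Bsym qE]]]; exists B, (L + 2 *: B z); split=> // x y.
rewrite addrAC (qE (x + z)) add_lfunE scale_lfunE (Bsym (x + z)) linearD /=.
rewrite (Bsym y x) (Bsym y z).
by rewrite /GRing.scale /=; ring.
Qed.

(** Vanishing on the hyperplane through [x1] makes [L] divide [q] on [x1 + W]. The cofactor is
    affine, and its zeros give the second hyperplane. *)
Lemma quadratic_fun_hyperplanes q W L w' x0 x1 :
  quadratic_fun q -> w' \in W -> L w' != 0 -> x1 - x0 \in W ->
  (forall h, h \in W -> L h = 0 -> q (x1 + h) = 0) ->
  (exists2 x, x - x0 \in W & q x != 0) ->
  exists x2 W', \dim W' = \dim (W :&: lker L) /\
    forall x, x - x0 \in W -> q x = 0 ->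
      x - x1 \in (W :&: lker L)%VS \/ x - x2 \in W'.
Proof.
move=> [B [l [Bsym qE]]] w'W Lw' x1W qH [x xW qx].
have [w wW Lw] : exists2 w, w \in W & L w = 1.
  by exists ((L w')^-1 *: w'); rewrite ?memvZ // linearZ; exact: mulVf.
have L1 : L w != 0 by rewrite Lw oner_neq0.
have BD a b b' : B a (b + b') = B a b + B a b' by rewrite linearD.
have lZ k b : l (k *: b) = k * l b by rewrite linearZ.
have BZ a k b : B a (k *: b) = k * B a b by rewrite linearZ.
(* The cofactor comes from expanding [q] at [x1 + h + L v *: w] with [L h = 0] and [L w = 1]. *)
pose La := 2 *: B w - (B w w) *: L; pose c := 2 * B x1 w + l w.
have qW v : v \in W -> q (x1 + v) = L v * (La v + c).
  move=> vW; pose h := v - L v *: w.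
  have hW : h \in W by rewrite memvB ?memvZ.
  have Lh : L h = 0.
    by rewrite linearB linearZ /= Lw /GRing.scale /= mulr1 subrr.
  have -> : x1 + v = (x1 + h) + L v *: w by rewrite -addrA subrK.
  rewrite qE qH // /La /c add_lfunE opp_lfunE !scale_lfunE.
  rewrite lZ !BZ (Bsym (x1 + h) w) (Bsym (L v *: w) w) !BZ.
  by rewrite /h -scaleNr !BD BZ (Bsym w x1) /GRing.scale /=; ring.
have toW y : y - x0 \in W -> y - x1 \in W.
  by move=> yW; rewrite -(subrKA x0) -[x0 - x1]opprB memvB.
have xE y : y = x1 + (y - x1) by rewrite addrC subrK.
have [[v2 v2W Lav2]|nov2] := pselect (exists2 v, v \in W & La v + c = 0).
  have [[w2 w2W Law2]|La0] := pselect (exists2 v, v \in W & La v != 0).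
    exists (x1 + v2), (W :&: lker La)%VS; split.
      by apply: succn_inj; rewrite (dim_cap_lker_form _ _ w2) //
        (dim_cap_lker_form _ _ w).
    move=> y yW; rewrite {1}(xE y) qW ?toW // => /eqP; rewrite mulf_eq0.
    have -> : y - (x1 + v2) = y - x1 - v2 by rewrite opprD addrA.
    rewrite !memv_cap !memv_ker toW // => /orP[->|/eqP Lay]; [by left|right].
    rewrite memvB ?toW // linearB subr_eq0 /=; apply/eqP/(@addIr _ c).
    by rewrite Lay Lav2.
  (* A cofactor that vanishes identically on [W] contradicts [q x != 0]. *)
  have La0W v : v \in W -> La v = 0.
    by move=> vW; apply/eqP/negPn/negP => Lav; case: La0; exists v.
  have c0 : c = 0 by rewrite -Lav2 La0W // add0r.
  by move: qx; rewrite (xE x) qW ?toW // La0W ?toW // c0 addr0 mulr0 eqxx.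
(* The cofactor has no zero on [W], so the first hyperplane is repeated. *)
exists x1, (W :&: lker L)%VS; split=> // y yW.
rewrite {1}(xE y) qW ?toW // => /eqP; rewrite mulf_eq0 memv_cap memv_ker.
move=> /orP[Ly|/eqP Lay]; first by left; rewrite toW.
by case: nov2; exists (y - x1); rewrite ?toW.
Qed.

End Quadratic.

(** * The induction on the dimension *)

(** Compares powers of 2 at the end of the induction: [p.+1] factors from [t = 2h] and one from
    [C + 1 <= 2 * C], against the square of the claimed bound. *)
Lemma exponent_le d r p : (p.+2 <= r)%N ->
  (p.+1 + (d * r + 1).+1 <= (d.+1 * r + 1) * 2)%N.
Proof. by nia. Qed.

Section Main.
Context {R : rcfType} {V : vectType R}.
Implicit Types (q : V -> R) (U W : {vspace V}) (L : 'Hom(V, R^o)).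

(** Union bound over the two hyperplanes, with the coset bound for each. *)
Lemma sgmean_containing_hyperplane (Bs : seq (seq V)) q W L w x0 x1 :
  {in Bs, forall B, basis_of fullv B} ->
  quadratic_fun q -> w \in W -> L w != 0 -> x1 - x0 \in W ->
  (forall h, h \in W -> L h = 0 -> q (x1 + h) = 0) ->
  (exists2 x, x - x0 \in W & q x != 0) ->
  sgmean (flatten Bs) (fun x => ((x - x0 \in W) && (q x == 0))%:R) *
    Num.sqrt (size Bs)%:R ^+ (dim V - (\dim W).-1) <= 2 :> R.
Proof.
move=> Bbasis qquad wW Lw x1W qH qW.
have [x2 [W' [dimW' zeros]]] :=
  quadratic_fun_hyperplanes _ _ _ _ _ _ qquad wW Lw x1W qH qW.
have dimH := dim_cap_lker_form _ _ _ wW Lw.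
have := sgmean_coset_le Bs (W :&: lker L) x1 Bbasis.
have := sgmean_coset_le Bs W' x2 Bbasis.
rewrite dimW' -dimH /=; set c := (_ - _)%N => le2 le1.
have s0 : 0 <= Num.sqrt (size Bs)%:R ^+ c :> R by rewrite exprn_ge0 ?sqrtr_ge0.
apply: le_trans (lerD le1 le2); rewrite -mulrDl -sgmeanD ler_wpM2r //.
apply: le_sgmean => x; case: andP => [[xW /eqP qx]|_]; last by rewrite addr_ge0.
by have [->|->] := zeros x xW qx; rewrite ?lerDl ?lerDr.
Qed.

(** Along the line [q] is a polynomial of degree at most 2 in [k] with equal values at 0, 1 and 2,
    hence constant. *)
Lemma quadratic_fun_invariant_line q W x0 u :
  quadratic_fun q -> u \in W ->
  (forall x, x - x0 \in W -> q (x + u) = q x) ->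
  forall k x, x - x0 \in W -> q (x + k *: u) = q x.
Proof.
move=> [B [l [Bsym qE]]] uW qu k x xW.
have BZ a j b : B a (j *: b) = j * B a b by rewrite linearZ.
have BD a b b' : B a (b + b') = B a b + B a b' by rewrite linearD.
have lZ j b : l (j *: b) = j * l b by rewrite linearZ.
have e1 := qu x xW; have xuW : x + u - x0 \in W by rewrite addrAC memvD.
have e2 := qu _ xuW.
rewrite qE in e1; rewrite (qE (x + u)) (Bsym (x + u)) BD (Bsym u x) in e2.
have Buu : B u u = 0 by move: e1 e2; lra.
rewrite qE !BZ (Bsym (k *: u)) BZ lZ.
have : 2 * B x u + l u = 0 by move: e1; lra.
move=> e3; rewrite Buu.
have -> : 2 * (k * B x u) + k * (k * 0) + k * l u = k * (2 * B x u + l u) by ring.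
by rewrite e3 mulr0 addr0.
Qed.

(** Decoupling: for each value of the part from [s2], the square of the mean over [s1] is a mean
    over two independent copies. *)
Lemma sgmean_sqr_fiber (s1 s2 : seq V) (f : V -> R) :
  sgmean (s1 ++ s2) f ^+ 2 <=
  sgmean s1 (fun y1 => sgmean s1 (fun y2 =>
    sgmean s2 (fun z => f (y1 + z) * f (y2 + z)))).
Proof.
rewrite sgmean_cat exchange_sgmean; apply: le_trans (sgmean_sqr _ _) _.
rewrite le_eqVlt; apply/orP; left; apply/eqP.
under [RHS]eq_sgmean => y1 do rewrite exchange_sgmean.
rewrite [RHS]exchange_sgmean; apply: eq_sgmean => z.
rewrite expr2 -sgmeanZ; apply: eq_sgmean => y2.
by rewrite mulrC -sgmeanZ; apply: eq_sgmean => y1; rewrite mulrC.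
Qed.

(** Moving an invariant direction into [U] lowers [d] by one and leaves the exponent
    [dim V - \dim U - d] unchanged. Divisibility by [2 ^ d] allows [d] successive halvings. *)
Lemma quadric_bound d (Bs : seq (seq V)) W U q x0 :
  {in Bs, forall B, basis_of fullv B} ->
  (0 < size Bs)%N -> (2 ^ d %| size Bs)%N ->
  (U <= W)%VS -> \dim W = (d.+1 + \dim U)%N ->
  quadratic_fun q ->
  (forall u x, u \in U -> x - x0 \in W -> q (x + u) = q x) ->
  (exists2 x, x - x0 \in W & q x != 0) ->
  sgmean (flatten Bs) (fun x => ((x - x0 \in W) && (q x == 0))%:R) *
    Num.sqrt (size Bs)%:R ^+ (dim V - \dim U - d) <= 2 ^+ (d * dim V + 1) :> R.
Proof.
elim: d Bs W U q x0 => [|d IH] Bs W U q x0 Bbasis t0 tdvd UW dimW qquad qU qW.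
  rewrite mul0n subn0 add0n expr1.
  (* For [d = 0], [U] is a hyperplane of [W], and a zero of [q] brings its whole coset of [U]. *)
  have [[x1 x1W qx1]|nozero] := pselect (exists2 x, x - x0 \in W & q x = 0).
    have [L [w [wW Lw UE]]] := hyperplane_form U W UW dimW.
    have := sgmean_containing_hyperplane Bs q W L w x0 x1 Bbasis qquad wW Lw x1W.
    rewrite dimW; apply=> // h hW Lh; rewrite qU //.
    by rewrite -UE memv_cap hW memv_ker Lh eqxx.
  rewrite (eq_sgmean _ _ (fun=> 0)) ?sgmean_cst ?mul0r // => x.
  by case: andP => // -[xW /eqP qx]; case: nozero; exists x.
have tdvd' : (2 ^ d %| size Bs)%N by apply: dvdn_trans tdvd; rewrite expnS dvdn_mull.
have dimV : (\dim W <= dim V)%N by rewrite -dimvf dimvS ?subvf.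
have rle : (d * dim V + 1 <= d.+1 * dim V + 1)%N by rewrite mulSn; lia.
have [[u [uW uU qu]]|noline] := pselect (exists u, [/\ u \in W, u \notin U &
    forall x, x - x0 \in W -> q (x + u) = q x]).
  have dimU' : \dim (U + <[u]>) = (\dim U).+1.
    rewrite dimv_disjoint_sum ?dim_vline.
      by rewrite (_ : u != 0) ?addn1 //; apply: contraNneq uU => ->; exact: mem0v.
    apply/eqP; rewrite -subv0; apply/subvP => x /memv_capP[xU /vlineP[k xk]].
    move: xU; rewrite xk rpredZeq (negPf uU) orbF => /eqP ->.
    by rewrite scale0r mem0v.
  have := IH Bs W (U + <[u]>)%VS q x0 Bbasis t0 tdvd'.
  rewrite dimU' dimW addnS (_ : (_ - _.+1 - d = dim V - \dim U - d.+1)%N); last lia.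
  move=> /(_ _ _ qquad _ qW) IH'; apply: le_trans (IH' _ _ _) _ => //.
  - by rewrite subv_add UW -memvE.
  - move=> v x /memv_addP[u' u'U [_ /vlineP[k ->] ->]] xW.
    rewrite addrA (quadratic_fun_invariant_line q W x0 u) ?qU //.
    by rewrite addrAC memvD // (subvP UW).
  - by rewrite ler_eXn2l // ltr1n.
have [[L [w [x1 [wW Lw x1W qH]]]]|nohyp] := pselect (exists L w x1,
    [/\ w \in W, L w != 0, x1 - x0 \in W &
        forall h, h \in W -> L h = 0 -> q (x1 + h) = 0]).
  have := sgmean_containing_hyperplane Bs q W L w x0 x1 Bbasis qquad wW Lw x1W qH qW.
  rewrite dimW /= [X in (_ - X)%N]addnC subnDA.
  move=> le2; apply: le_trans le2 _.
  by rewrite addn1 exprS ler_peMr // exprn_ege1 // ler1n.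
(* In the remaining case the bases are split into two halves of size [h]. *)
have [B [l [Bsym qE]]] := qquad.
set h := (size Bs)./2.
have th : size Bs = (h + h)%N.
  rewrite addnn -[LHS]odd_double_half -/h.
  have : (2 %| size Bs)%N by apply: dvdn_trans tdvd; rewrite expnS dvdn_mulr.
  by rewrite dvdn2 => /negPf ->.
have h0 : (0 < h)%N by move: t0; rewrite th; case: (h).
have hdvd : (2 ^ d %| h)%N by rewrite -(@dvdn_pmul2l 2) // -expnS mul2n -addnn -th.
set Bs1 := take h Bs; set Bs2 := drop h Bs.
have sz1 : size Bs1 = h by rewrite size_takel // th leq_addr.
have sz2 : size Bs2 = h by rewrite size_drop th addnK.
have basis1 : {in Bs1, forall b, basis_of fullv b} by move=> b /mem_take /Bbasis.
have basis2 : {in Bs2, forall b, basis_of fullv b} by move=> b /mem_drop /Bbasis.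
set s := Num.sqrt h%:R : R.
have s2 : s ^+ 2 = h%:R by rewrite sqr_sqrtr ?ler0n.
have s_ge1 : 1 <= s by rewrite -[leLHS]sqrtr1 ler_wsqrtr // ler1n.
have sX_gt0 k : 0 < s ^+ k by rewrite exprn_gt0 // (lt_le_trans ltr01).
have sX_ge0 k : 0 <= s ^+ k by exact: ltW.
have coset1 W' x : sgmean (flatten Bs1) (fun y => (y - x \in W')%:R) <=
    (s ^+ (dim V - \dim W'))^-1.
  by rewrite -[leRHS]div1r ler_pdivlMr //; have := sgmean_coset_le _ W' x basis1;
     rewrite sz1.
have coset2 W' x : sgmean (flatten Bs2) (fun y => (y - x \in W')%:R) <=
    (s ^+ (dim V - \dim W'))^-1.
  by rewrite -[leRHS]div1r ler_pdivlMr //; have := sgmean_coset_le _ W' x basis2;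
     rewrite sz2.
set p := (dim V - \dim W)%N.
have dimE : dim V = (d.+2 + \dim U + p)%N by rewrite -dimW subnKC.
have dimVU : (dim V - \dim U = d.+2 + p)%N by rewrite dimE; lia.
rewrite dimVU (_ : (_ - d.+1)%N = p.+1); last lia.
set C : R := 2 ^+ (d * dim V + 1).
have C_ge0 : 0 <= C by rewrite exprn_ge0.
pose f x : R := ((x - x0 \in W) && (q x == 0))%:R.
rewrite -/f -(cat_take_drop h Bs) flatten_cat cat_take_drop -/Bs1 -/Bs2.
(* Here [y1] and [y2] are values of the first half. A difference in [U] leaves the coset bound for
   [W]; one in [W] but not in [U] leads to the induction hypothesis, with exponent [p.+2]; any other
   gives 0. *)
have fiber y1 y2 : sgmean (flatten Bs2) (fun z => f (y1 + z) * f (y2 + z)) <=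
    C / s ^+ p.+2 * (y2 - y1 \in W)%:R + (s ^+ p)^-1 * (y2 - y1 \in U)%:R.
  have Cge0 : 0 <= C / s ^+ p.+2 by rewrite divr_ge0.
  have sge0 : 0 <= (s ^+ p)^-1 by rewrite invr_ge0.
  have [uU|uU] := boolP (y2 - y1 \in U).
    rewrite mulr1; apply: le_trans (_ : (s ^+ p)^-1 <= _); last first.
      by rewrite lerDr mulr_ge0.
    apply: le_trans (coset2 W (x0 - y1)); apply: le_sgmean => z.
    rewrite opprB addrA [z + y1]addrC /f; case: (_ \in W) => /=; last by rewrite mul0r.
    by rewrite -natrM lern1; do 2!case: (_ == 0) => //; case: (_ \in W).
  rewrite mulr0 addr0.
  have [uW|uW] := boolP (y2 - y1 \in W); last first.
    rewrite mulr0 (eq_sgmean _ _ (fun=> 0)) ?sgmean_cst // => z.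
    rewrite /f; case: andP => [[z1 _]|_]; last by rewrite mul0r.
    case: andP => [[z2 _]|_]; last by rewrite mulr0.
    case/negP: uW; have -> : y2 - y1 = (y2 + z - x0) - (y1 + z - x0).
      by rewrite opprB addrA subrK opprD addrACA subrr addr0.
    exact: memvB.
  rewrite mulr1; set u := y2 - y1 in uU uW.
  have y2E : y2 = y1 + u by rewrite addrC subrK.
  (* If [q] never agrees at the two points, it cannot vanish at both. *)
  have [[z0 z0W z0q]|noz] := pselect (exists2 z, y1 + z - x0 \in W &
      q (y1 + z + u) = q (y1 + z)); last first.
    rewrite (eq_sgmean _ _ (fun=> 0)) ?sgmean_cst // => z.
    rewrite /f; case: andP => [[z1 /eqP qz1]|_]; last by rewrite mul0r.
    case: andP => [[z2 /eqP qz2]|_]; last by rewrite mulr0.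
    by case: noz; exists z => //; rewrite qz1 -qz2 y2E addrAC.
  (* The difference of [q] along [u] is affine with linear part [2 * L]. *)
  pose L := B u.
  have qL x v : q (x + v + u) - q (x + v) = q (x + u) - q x + 2 * L v.
    by rewrite (qE (x + v)) (qE x u) (Bsym (x + v)) linearD /= (Bsym u x) /L; lra.
  (* If [L] vanished on [W], this difference would be constant, equal to its value 0 at [y1 + z0],
     and [u] would be an invariant direction. *)
  have [w wW Lw] : exists2 w, w \in W & L w != 0.
    apply: contrapT => L0; apply: noline; exists u; split=> // x xW.
    have xz0W : x - (y1 + z0) \in W by rewrite -(subrKA x0) -[x0 - _]opprB memvB.
    have := qL (y1 + z0) (x - (y1 + z0)); rewrite [_ + (x - _)]addrC subrK z0q subrr.
    have -> : L (x - (y1 + z0)) = 0.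
      by apply/eqP/negPn/negP => Lx; apply: L0; exists (x - (y1 + z0)).
    by rewrite mulr0 addr0 => /eqP; rewrite subr_eq0 => /eqP.
  have dimH := dim_cap_lker_form _ _ _ wW Lw.
  have toW z : z - z0 \in W -> z + y1 - x0 \in W.
    move=> zW; have -> : z + y1 - x0 = (z - z0) + (y1 + z0 - x0).
      by rewrite !addrA [z - z0 + y1]addrAC subrK.
    exact: memvD.
  (* Two simultaneous zeros force [z - z0] into [W :&: lker L]; the induction hypothesis applies
     there to [q] translated by [y1]. *)
  rewrite ler_pdivlMr //; apply: le_trans (ler_wpM2r (ltW (sX_gt0 _)) _) _; last first.
    have := IH Bs2 (W :&: lker L)%VS U (fun z => q (z + y1)) z0 basis2.
    rewrite sz2 dimVU.
    have -> : (d.+2 + p - d)%N = p.+2 by rewrite !addSnnS addKn.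
    apply=> //.
    (* Moving by [v] in [U] changes neither [q (y1 + z0)] nor [q (y1 + z0 + u)], so [L v = 0]. *)
    - rewrite subv_cap UW; apply/subvP => v vU; rewrite memv_ker; apply/eqP.
      have e1 := qU v _ vU z0W; have e2 : q (y1 + z0 + u + v) = q (y1 + z0 + u).
        by apply: qU => //; rewrite addrAC memvD.
      have := qL (y1 + z0) v; rewrite -addrAC e2 e1; lra.
    - by apply: succn_inj; rewrite dimH dimW.
    - exact: (quadratic_fun_shift q y1).
    - move=> v z vU /memv_capP[zW _]; rewrite addrAC qU //; exact: toW.
    (* Otherwise the zero set of [q] would contain a hyperplane of [x0 + W]. *)
    - apply: contrapT => qH; apply: nohyp; exists L, w, (y1 + z0); split=> // v vW Lv.
      apply/eqP/negPn/negP => qv; apply: qH; exists (z0 + v).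
        by rewrite addrC addKr memv_cap vW memv_ker Lv eqxx.
      by rewrite addrC addrA.
  apply: le_sgmean => z; rewrite /f.
  case: andP => [[z1 /eqP qz1]|_]; last by rewrite mul0r.
  case: andP => [[z2 /eqP qz2]|_]; last by rewrite mulr0.
  have zz0 : z - z0 \in W.
    have -> : z - z0 = (y1 + z - x0) - (y1 + z0 - x0).
      by rewrite opprB addrA subrK opprD addrACA subrr add0r.
    exact: memvB.
  rewrite mulr1 memv_cap zz0 memv_ker (addrC z y1) qz1 eqxx andbT /= ler1n lt0b.
  have e : y1 + z0 + (z - z0) = y1 + z by rewrite -addrA [z0 + _]addrC subrK.
  have := qL (y1 + z0) (z - z0); rewrite e z0q subrr add0r qz1.
  rewrite addrAC -y2E qz2 subrr => /esym/eqP.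
  by rewrite mulf_eq0 pnatr_eq0 /= => ->.
(* For each fixed [y1], the coset bound controls [y2 - y1] in [W] and in [U], of codimensions [p]
   and [d.+2 + p]. *)
have Psqr : sgmean (flatten Bs1 ++ flatten Bs2) f ^+ 2 <=
    C / s ^+ p.+2 * (s ^+ p)^-1 + (s ^+ p)^-1 * (s ^+ (d.+2 + p))^-1.
  apply: le_trans (sgmean_sqr_fiber _ _ _) _; apply: sgmean_le => y1.
  apply: le_trans (le_sgmean _ _ _ (fiber y1)) _.
  rewrite sgmeanD !sgmeanZ -dimVU lerD // ler_wpM2l ?coset1 //.
    by rewrite divr_ge0.
  by rewrite invr_ge0.
have P0 : 0 <= sgmean (flatten Bs1 ++ flatten Bs2) f by apply: sgmean_ge0 => x.
rewrite -(@ler_pXn2r _ 2) ?nnegrE ?mulr_ge0 ?exprn_ge0 ?sqrtr_ge0 //.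
rewrite exprMn -exprM mulnC exprM sqr_sqrtr ?ler0n // th addnn -mul2n natrM -s2.
apply: le_trans (ler_wpM2r _ Psqr) _; first by rewrite exprn_ge0 // mulr_ge0 ?sqr_ge0.
(* The scaling turns the first term into [C] and the second into the inverse of [s ^+ d], which is
   at most 1. *)
set P := C / _ * _ + _; have PE : P * (s ^+ 2) ^+ p.+1 <= C + 1.
  have sn k : s ^+ k != 0 by rewrite gt_eqF.
  have -> : P * (s ^+ 2) ^+ p.+1 = C + (s ^+ d)^-1.
    rewrite /P -exprM.
    rewrite (_ : (2 * p.+1)%N = (p + p.+2)%N); last lia.
    rewrite (_ : (d.+2 + p)%N = (d + p.+2)%N); last lia.
    rewrite !exprD; have := sn p; have := sn p.+2; have := sn d.
    by move=> ? ? ?; field; apply/and3P.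
  by rewrite lerD2l invf_le1 // exprn_ege1.
rewrite exprMn mulrCA; apply: le_trans (ler_wpM2l _ PE) _; first exact: exprn_ge0.
have C1 : 1 <= C by rewrite exprn_ege1 // ler1n.
apply: le_trans (_ : 2 ^+ p.+1 * (2 * C) <= _).
  by rewrite ler_wpM2l ?exprn_ge0 //; lra.
rewrite /C -exprS -exprD -exprM ler_eXn2l ?ltr1n //.
have pV : (p.+2 <= dim V)%N by rewrite dimE -addn2 [leqRHS]addnC leq_add2l.
exact: exponent_le.
Qed.

End Main.

Local Open Scope classical_set_scope.
Local Open Scope ring_scope.

(** * From probability spaces to random signs *)

Section Transfer.
Context {R : realType} {disp : measure_display} {Omega : measurableType disp}
  {P : probability Omega R} {n : nat} {xi : 'I_n -> {RV P >-> R}}.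

Lemma measurable_RV_eq i (c : R) : measurable [set w | xi i w = c].
Proof.
by rewrite (_ : [set w | _] = xi i @^-1` [set c]).
Qed.

Lemma measurable_sign_event (J : {set 'I_n}) (c : 'I_n -> R) :
  measurable [set w | forall i, i \in J -> xi i w = c i].
Proof.
have -> : [set w | forall i, i \in J -> xi i w = c i] =
    \bigcap_(i in [set i | i \in J]) (xi i @^-1` [set c i]).
  by apply/seteqP; split=> w h i /h.
exact: fin_bigcap_measurable.
Qed.

Context (hxi : forall i, rademacher (xi i)) (hind : independent_RVs xi).

Definition sign_val (b : bool) : R := if b then 1 else - 1.

Lemma sign_event_prob (J : {set 'I_n}) (e : 'I_n -> bool) :
  P [set w | forall i, i \in J -> xi i w = sign_val (e i)] =
  (2^-1 ^+ #|J|)%:E.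
Proof.
have := hind J (fun i => [set sign_val (e i)]).
move=> -> => [|i]; last exact: measurable_set1.
rewrite (eq_bigr (fun=> (2^-1)%:E)) => [|i _].
  by rewrite prodEFin prodr_const.
by have [h1 h2] := hxi i; rewrite /sign_val; case: (e i).
Qed.

(** The variables are signs only almost surely: the values 1 and -1 already carry mass 1/2 each. *)
Lemma not_sign_prob i : P [set w | ~ (xi i w = 1 \/ xi i w = -1)] = 0%E.
Proof.
have mS := measurable_RV_eq i.
rewrite (_ : [set w | _] = ~` ([set w | xi i w = 1] `|` [set w | xi i w = -1])) //.
rewrite probability_setC; last exact: measurableU.
have -> : P ([set w | xi i w = 1%R] `|` [set w | xi i w = (-1)%R]) =
    (P [set w | xi i w = 1%R] + P [set w | xi i w = (-1)%R])%E.
  apply: measureU => //; apply/seteqP; split=> // w /= [-> /eqP].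
  by rewrite -subr_eq0 opprK -(natrD _ 1 1) pnatr_eq0.
have [-> ->] := hxi i.
have half2 : 2^-1 + 2^-1 = 1 :> R by field.
by rewrite -EFinD half2 subrr.
Qed.

(** The signs are revealed one at a time, following the recursion of [sgmean]. As only an upper
    bound is claimed, the null sets of other values are simply added. *)
Lemma rademacher_sgmean_le (V : lmodType R) (a : 'I_n -> V) (A : pred V) :
  measurable [set w | A (\sum_(i < n) xi i w *: a i)] ->
  (P [set w | A (\sum_(i < n) xi i w *: a i)%R] <=
   (sgmean [seq a i | i <- enum 'I_n] (fun x => (A x)%:R))%:E)%E.
Proof.
move=> mE; set E := [set w | _].
pose D (J : {set 'I_n}) (e : 'I_n -> bool) :=
  [set w | forall i, i \in J -> xi i w = sign_val (e i)].
have mD J e : measurable (D J e) by exact: measurable_sign_event.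
(* [J] holds the indices already revealed, [e] their signs, and [s] the indices still random. *)
suff main s (J : {set 'I_n}) (e : 'I_n -> bool) : uniq s ->
    (forall i, (i \in J) = (i \notin s)) ->
    (P (E `&` D J e) <= (2^-1 ^+ #|J| * sgmean [seq a i | i <- s]
      (fun x => (A (\sum_(i in J) sign_val (e i) *: a i + x))%:R))%:E)%E.
  have := main (enum 'I_n) finset.set0 (fun=> true) (enum_uniq _).
  rewrite (_ : D _ _ = setT) ?setIT; last first.
    by apply/seteqP; split=> // w _ i; rewrite inE.
  rewrite cards0 expr0 mul1r big_set0.
  under [sgmean _ _]eq_sgmean => x do rewrite add0r.
  by apply=> i; rewrite inE mem_enum.
have le_P (B C : set Omega) : measurable B -> measurable C -> B `<=` C ->
    (P B <= P C)%E by move=> mB mC; apply: le_measure; rewrite inE.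
elim: s J e => [|i s IH] J e /=.
  (* With all signs known the sum is [y], so the event is all of [D J e] or empty. *)
  move=> _ Js; set y := \sum_(i in J) _.
  have Dy w : D J e w -> \sum_(i < n) xi i w *: a i = y.
    move=> De; rewrite /y [RHS](eq_bigl xpredT) => [|j]; last by rewrite Js.
    by apply: eq_bigr => j _; rewrite De // Js.
  rewrite addr0; case: (boolP (A y)) => Ay.
    rewrite mulr1 -(sign_event_prob J e).
    by apply: le_P => [||w []//]; [exact: measurableI|exact: mD].
  rewrite mulr0 (_ : _ `&` _ = set0) ?measure0 //.
  apply/seteqP; split=> // w [Ew /Dy yE]; move: Ew; rewrite /E /= yE.
  by rewrite (negPf Ay).
move=> /andP[ils us] Js; have iJ : i \notin J by rewrite Js mem_head.
pose e' b j := if j == i then b else e j; pose J' := (i |: J)%SET.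
have J's j : (j \in J') = (j \notin s).
  rewrite !inE Js inE negb_or; case: eqVneq => [->|//]; exact/esym.
have IHb b : (P (E `&` D J' (e' b)) <= (2^-1 ^+ #|J|.+1 * sgmean [seq a i | i <- s]
    (fun x => (A (\sum_(i in J) sign_val (e i) *: a i +
      (sign_val b *: a i + x)))%:R))%:E)%E.
  have e'J' : \sum_(j in J') sign_val (e' b j) *: a j =
      \sum_(j in J) sign_val (e j) *: a j + sign_val b *: a i.
    rewrite big_setU1 //= addrC /e' eqxx; congr (_ + _); apply: eq_bigr => j jJ.
    by case: eqVneq jJ => // ->; rewrite (negPf iJ).
  under eq_sgmean => x do rewrite addrA.
  by have := IH J' (e' b) us J's; rewrite cardsU1 iJ add1n e'J'.
pose N := [set w | ~ (xi i w = 1 \/ xi i w = -1)].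
have mN : measurable N.
  rewrite (_ : N = ~` ([set w | xi i w = 1] `|` [set w | xi i w = -1])) //.
  by apply: measurableC; apply: measurableU; exact: measurable_RV_eq.
(* Split by the sign of [xi i], up to the null set [N]. *)
have cover : E `&` D J e `<=`
    (E `&` D J' (e' true)) `|` (E `&` D J' (e' false)) `|` N.
  move=> w [Ew Dw].
  have De' b : xi i w = sign_val b -> D J' (e' b) w.
    move=> xb j; rewrite !inE /e'; case: eqVneq => [-> _ //|_ /=]; exact: Dw.
  have [x1|x1] := pselect (xi i w = 1); first by left; left; split=> //; exact: De'.
  have [x2|x2] := pselect (xi i w = -1); first by left; right; split=> //; exact: De'.
  by right; case.
have mED b : measurable (E `&` D J' (e' b)) by exact: measurableI.
have mEDU := measurableU _ _ (mED true) (mED false).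
apply: (le_trans (le_P _ _ _ _ cover)); [exact: measurableI|exact: measurableU|].
apply: (le_trans (measureU2 _ _ _)) => //.
rewrite [X in (_ + X)%E]not_sign_prob adde0.
apply: (le_trans (measureU2 _ _ _)) => //.
apply: (le_trans (leeD (IHb true) (IHb false))).
rewrite -EFinD lee_fin le_eqVlt; apply/orP; left; apply/eqP.
rewrite /sign_val; under [sgmean _ _]eq_sgmean => x do rewrite scale1r.
under [X in _ + _ * X = _]eq_sgmean => x do rewrite scaleN1r.
by rewrite exprSr; field.
Qed.

End Transfer.

(** * Polynomials of degree at most 2 as quadratic functions *)

Section QuadraticClosure.
Context {R : rcfType} {V : vectType R}.
Implicit Types (q : V -> R) (L : 'Hom(V, R^o)).

Lemma quadratic_fun_cst c : quadratic_fun (fun _ : V => c).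
Proof.
exists (fun=> 0), 0; split=> x y;
  by rewrite /= !zero_lfunE ?mulr0 ?addr0.
Qed.

Lemma quadratic_fun_linear L : quadratic_fun (L : V -> R).
Proof.
exists (fun=> 0), L; split=> x y; rewrite /= !zero_lfunE //.
by rewrite mulr0 !add0r linearD.
Qed.

Lemma quadratic_fun_mul L1 L2 : quadratic_fun (fun x : V => (L1 x : R) * L2 x).
Proof.
exists (fun x => (L1 x / 2) *: L2 + (L2 x / 2) *: L1), 0; split=> x y;
  by rewrite !(add_lfunE, scale_lfunE, zero_lfunE) ?linearD /GRing.scale /=; field.
Qed.

Lemma quadratic_funD q1 q2 : quadratic_fun q1 -> quadratic_fun q2 ->
  quadratic_fun (fun x => q1 x + q2 x).
Proof.
move=> [B1 [L1 [B1s q1E]]] [B2 [L2 [B2s q2E]]].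
exists (fun x => B1 x + B2 x), (L1 + L2); split=> x y.
  by rewrite !add_lfunE B1s B2s.
by rewrite q1E q2E !add_lfunE; ring.
Qed.

Lemma quadratic_funZ c q : quadratic_fun q -> quadratic_fun (fun x => c * q x).
Proof.
move=> [B [L [Bs qE]]]; exists (fun x => c *: B x), (c *: L); split=> x y.
  by rewrite !scale_lfunE Bs.
by rewrite qE !scale_lfunE /GRing.scale /=; ring.
Qed.

Lemma eq_quadratic_fun q1 q2 : q1 =1 q2 -> quadratic_fun q1 -> quadratic_fun q2.
Proof. by move=> q12 [B [L [Bs qE]]]; exists B, L; split=> // x y; rewrite -!q12. Qed.

Lemma quadratic_fun_sum (I : Type) (s : seq I) (F : I -> V -> R) (c : pred I) :
  (forall i, c i -> quadratic_fun (F i)) -> all c s ->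
  quadratic_fun (fun x => \sum_(i <- s) F i x).
Proof.
move=> Fq; elim: s => [_|i s IH /= /andP[ci cs]].
  apply: (eq_quadratic_fun (fun=> 0)) (quadratic_fun_cst 0) => x.
  by rewrite big_nil.
apply: eq_quadratic_fun (quadratic_funD _ _ (Fq i ci) (IH cs)) => x.
by rewrite big_cons.
Qed.

(** Peeling off variables turns a monomial of degree at most 2 into a product of at most two linear
    forms. *)
Lemma monomial_factor n (e : 'I_n -> nat) k : (\sum_i e i)%N = k.+1 ->
  exists i e', (\sum_i e' i)%N = k /\
    forall x : 'I_n -> R, \prod_i x i ^+ e i = x i * \prod_i x i ^+ e' i.
Proof.
move=> ek; have /existsP[i ei] : [exists i, e i != 0%N].
  apply: contraPT ek; rewrite negb_exists => /forallP e0.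
  by rewrite big1 // => j _; apply/eqP; rewrite -[_ == _]negbK.
(* The truncated subtraction is exact because [e i] is nonzero. *)
pose e' j := (e j - (j == i))%N.
have e'E j : e j = ((j == i) + e' j)%N.
  by rewrite /e'; case: eqVneq => [->|_]; move: ei; lia.
exists i, e'; split.
  apply: succn_inj; rewrite -ek; under [in RHS]eq_bigr => j _ do rewrite e'E.
  rewrite [RHS]big_split /= [X in _ = (X + _)%N](bigD1 i) //= eqxx.
  by rewrite [X in (1 + X + _)%N]big1 // => j /negPf ->.
move=> x; under eq_bigr => j _ do rewrite e'E exprD.
rewrite big_split /= [X in X * _ = _](bigD1 i) //= eqxx.
by rewrite [X in _ * X * _]big1 ?mulr1 // => j /negPf ->.
Qed.

Lemma monomial0 n (e : 'I_n -> nat) : (\sum_i e i)%N = 0%N ->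
  forall x : 'I_n -> R, \prod_i x i ^+ e i = 1.
Proof.
move=> /eqP; rewrite sum_nat_eq0 => /forallP e0 x.
by rewrite big1 // => i _; rewrite (eqP (implyP (e0 i) isT)).
Qed.

Lemma quadratic_fun_monomial n (e : 'I_n -> nat) (L : 'I_n -> 'Hom(V, R^o)) :
  (\sum_i e i <= 2)%N -> quadratic_fun (fun x : V => \prod_i (L i x : R) ^+ e i).
Proof.
move=> e2; case ek : (\sum_i e i)%N e2 => [|[|[|//]]] _.
- apply: eq_quadratic_fun (quadratic_fun_cst 1) => x.
  by rewrite (monomial0 _ _ ek).
- have [i [e' [e'0 eE]]] := monomial_factor _ _ _ ek.
  apply: eq_quadratic_fun (quadratic_fun_linear (L i)) => x.
  by rewrite eE (monomial0 _ _ e'0) mulr1.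
- have [i [e' [e'1 eE]]] := monomial_factor _ _ _ ek.
  have [j [e'' [e''0 e'E]]] := monomial_factor _ _ _ e'1.
  apply: eq_quadratic_fun (quadratic_fun_mul (L i) (L j)) => x.
  by rewrite eE e'E (monomial0 _ _ e''0) mulr1.
Qed.

Lemma quadratic_fun_meval n (p : mpoly.mpoly n R) (L : 'I_n -> 'Hom(V, R^o)) :
  (mpoly.msize p <= 3)%N ->
  quadratic_fun (fun x : V => mpoly.meval (fun i => L i x : R) p).
Proof.
move=> p3; apply: eq_quadratic_fun (fun x => esym (mpoly.mevalE _ _)) _.
apply: (@quadratic_fun_sum _ _ _ (fun m => m \in mpoly.msupp p)).
  move=> m mp; apply: quadratic_funZ; apply: quadratic_fun_monomial.
  by rewrite -mpoly.mdegE -ltnS (leq_trans _ p3) // mpoly.msize_mdeg_lt.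
exact/allP.
Qed.

End QuadraticClosure.

(** * Measurability of functions of the signed sum *)

Section Measurability.
Context {R : realType} {disp : measure_display} {Omega : measurableType disp}
  {P : probability Omega R} {n : nat} {xi : 'I_n -> {RV P >-> R}}.
Context {V : vectType R} {a : 'I_n -> V}.

Lemma measurable_linear_signed_sum (L : 'Hom(V, R^o)) :
  measurable_fun setT (fun w => L (\sum_(i < n) xi i w *: a i) : R).
Proof.
rewrite (_ : (fun _ => _) = fun w => \sum_(i < n) xi i w * L (a i)).
  by apply: measurable_sum => i; apply: measurable_funM.
by apply/funext => w; rewrite linear_sum; apply: eq_bigr => i _; rewrite linearZ.
Qed.

Lemma measurable_quadratic_signed_sum (q : V -> R) : quadratic_fun q ->
  measurable_fun setT (fun w => q (\sum_(i < n) xi i w *: a i)).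
Proof.
move=> [B [L [Bs qE]]].
(* Expanding [q] at 0, and then one argument of [B], leaves finitely many products of measurable
   functions. *)
rewrite (_ : (fun _ => _) = fun w => q 0 +
    (\sum_(i < n) xi i w * (B (a i) (\sum_(j < n) xi j w *: a j) : R) +
     L (\sum_(i < n) xi i w *: a i))); last first.
  apply/funext => w; set X := \sum_(i < n) _.
  rewrite -{1}[X]add0r qE (Bs 0) linear0 mulr0 add0r; congr (_ + (_ + _)).
  rewrite {2}/X linear_sum; apply: eq_bigr => i _.
  by rewrite linearZ /= Bs.
apply: measurable_funD; first exact: measurable_cst.
apply: measurable_funD; last exact: measurable_linear_signed_sum.
apply: measurable_sum => i; apply: measurable_funM => //.
exact: measurable_linear_signed_sum.
Qed.

End Measurability.

(** * Quadrics, disjoint bases and events in the form used above *)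

Lemma quadric_on_quadratic_fun (R : realType) (r m : nat)
    (W Z : set 'rV[R]_r) :
  quadric_on m W Z -> exists q : 'rV[R]_r -> R,
  [/\ quadratic_fun q, Z = [set x | W x /\ q x = 0] & exists2 x, W x & q x != 0].
Proof.
move=> [[ZW WZ] [phi [Q [[[f [b phiE]] [phiW phiinj phisurj]] [p [_ p3 QE _]] ZE]]]].
(* [f] is injective, so [g] is a left inverse and [g (x - b)] inverts [phi] on [W]; values of [q]
   off [W] do not matter. *)
pose g := ((linfun f)^-1)%VF.
have gK x : g (f x) = x.
  rewrite -[f x]lfunE lker0_lfunK //; apply/lker0P => u v.
  rewrite !lfunE /= => fuv; apply: phiinj; rewrite ?inE // !phiE fuv //.
have /choice[L LE] : forall i : 'I_m, exists L : 'Hom('rV[R]_r, R^o),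
    forall x, L x = g x ord0 i.
  move=> i; apply: linear_form_hom => k x y.
  by rewrite linearP !mxE.
pose q x := mpoly.meval (fun i => g (x - b) ord0 i) p.
have qphi y : q (phi y) = mpoly.meval (fun i => y ord0 i) p.
  by rewrite /q phiE addrK gK.
have ZqE : Z = [set x | W x /\ q x = 0].
  apply/seteqP; split=> [x Zx|x [Wx qx]].
    split; first exact: ZW.
    by move: Zx; rewrite ZE QE => -[y py <-]; rewrite qphi.
  have [y _ yx] := phisurj _ Wx.
  by rewrite ZE QE; exists y => //; rewrite /zero_locus /= -qphi yx.
exists q; split=> //.
  have := quadratic_fun_shift _ (- b) (quadratic_fun_meval _ _ L p3).
  apply: eq_quadratic_fun => x; rewrite /q; congr (mpoly.meval _ p).
  by apply/funext => i; rewrite LE.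
apply: contrapT => nq; apply: WZ => x Wx; rewrite ZqE; split=> //.
by apply/eqP/negPn/negP => qx; apply: nq; exists x.
Qed.

(** The comparison is made on indices, where disjointness excludes repetitions even if vectors
    coincide; [s] collects the vectors outside the bases. *)
Lemma disjoint_bases_seq (R : realType) (r n t : nat) (a : 'I_n -> 'rV[R]_r) :
  disjoint_bases t a -> exists Bs s,
  [/\ {in Bs, forall B, basis_of fullv B}, size Bs = t &
      perm_eq [seq a i | i <- enum 'I_n] (flatten Bs ++ s)].
Proof.
move=> [J [Jdisj Jbasis]].
pose Is := [seq enum (J l) | l <- enum 'I_t].
exists [seq [seq a j | j <- K] | K <- Is],
  [seq a i | i <- enum 'I_n & i \notin flatten Is].
split.
- by move=> B /mapP[K /mapP[l _ ->] ->]; exact: Jbasis.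
- by rewrite /Is 2!size_map -cardE card_ord.
rewrite -map_flatten -map_cat; apply: perm_map; apply: uniq_perm.
- exact: enum_uniq.
- rewrite cat_uniq filter_uniq ?enum_uniq // andbT; apply/andP; split; last first.
    by apply/hasPn => i; rewrite mem_filter => /andP[].
  have : uniq (enum 'I_t) by exact: enum_uniq.
  rewrite /Is; elim: (enum 'I_t) => //= l ls IH /andP[lls uls].
  rewrite cat_uniq enum_uniq IH // andbT /=; apply/hasPn => i.
  move=> /flattenP[_ /mapP[k kls ->]]; rewrite mem_enum => iJk.
  suff : i \notin enum (J l) by []; rewrite mem_enum; apply/negP => iJl.
  have lk : l != k by apply: contraNneq lls => ->.
  by have := finset.in_set0 i; rewrite -(Jdisj l k lk) inE iJl iJk.
- move=> i; rewrite mem_cat mem_enum [in RHS]mem_filter mem_enum andbT.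
  by case: (i \in flatten Is).
Qed.

Lemma measurable_signed_sum_event (R : realType) (disp : measure_display)
    (Omega : measurableType disp) (P : probability Omega R) (r n : nat)
    (xi : 'I_n -> {RV P >-> R}) (a : 'I_n -> 'rV[R]_r) (U : {vspace 'rV[R]_r})
    (x0 : 'rV[R]_r) (q : 'rV[R]_r -> R) : quadratic_fun q ->
  measurable [set w | let x := \sum_(i < n) xi i w *: a i in
    (x - x0 \in U) && (q x == 0)].
Proof.
(* Membership in [U] amounts to [r] linear equations, the vanishing of the coordinates of
   [x - projv U x]. *)
move=> qquad; have /choice[L LE] : forall j : 'I_r,
    exists L : 'Hom('rV[R]_r, R^o), forall x, L x = (x - projv U x) ord0 j.
  move=> j; apply: linear_form_hom => k x y.
  by rewrite linearP !mxE; ring.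
have UE x : x \in U <-> forall j, L j x = 0.
  split=> [xU j|Lx]; first by rewrite LE projv_id // subrr mxE.
  rewrite (_ : x = projv U x) ?memv_proj //; apply/eqP; rewrite -subr_eq0.
  by apply/eqP/rowP => j; rewrite -LE Lx mxE.
pose X w := \sum_(i < n) xi i w *: a i.
rewrite (_ : [set w | _] =
    (\bigcap_(j in [set: 'I_r]) ((fun w => L j (X w) : R) @^-1` [set (L j x0 : R)]))
    `&` ((fun w => q (X w)) @^-1` [set 0])); last first.
  apply/seteqP; split=> w /=.
    move=> /andP[xU /eqP qx]; split=> // j _ /=.
    by move/UE: xU => /(_ j); rewrite linearB => /eqP; rewrite subr_eq0 => /eqP.
  move=> [Lx qx]; apply/andP; split; last exact/eqP.
  by apply/UE => j; rewrite linearB /=; apply/eqP; rewrite subr_eq0; apply/eqP/Lx.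
apply: measurableI.
  apply: fin_bigcap_measurable => // j _; rewrite -[X in measurable X]setTI.
  by apply: measurable_linear_signed_sum.
rewrite -[X in measurable X]setTI.
by apply: measurable_quadratic_signed_sum.
Qed.

Theorem theorem4p2 (R : realType) (d r : nat) (hdr : (d < r)%N)
  (W Z : set 'rV[R]_r)
  (hW : affine_subspace d.+1 W) (hZ : quadric_on d.+1 W Z)
  (t : nat) (ht : (0 < t)%N) (hdvd : (2 ^ d %| t)%N)
  (n : nat) (a : 'I_n -> 'rV[R]_r) (ha : disjoint_bases t a)
  (disp : measure_display) (Omega : measurableType disp)
  (P : probability Omega R) (xi : 'I_n -> {RV P >-> R})
  (hxi : forall i, rademacher (xi i)) (hind : independent_RVs xi) :
  (P [set w | Z (\sum_(i < n) xi i w *: a i)%R] <=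
   (2 ^+ (d * r + 1) / (t%:R `^ ((r%:R - d%:R) / 2)))%:E)%E.
Proof.
have [q [qquad ZE [x1 Wx1 qx1]]] := quadric_on_quadratic_fun _ _ _ _ _ hZ.
have [x0 [U [dimU WE]]] := hW.
have [Bs [s [Bbasis Bsz perm]]] := disjoint_bases_seq _ _ _ _ _ ha.
pose A x := (x - x0 \in U) && (q x == 0).
have -> : [set w | Z (\sum_(i < n) xi i w *: a i)] =
    [set w | A (\sum_(i < n) xi i w *: a i)].
  rewrite ZE WE; apply/seteqP; split=> w /=; first by move=> [? /eqP ?]; apply/andP.
  by move=> /andP[? /eqP].
apply: le_trans (rademacher_sgmean_le hxi hind _ a A _) _.
  exact: measurable_signed_sum_event.
rewrite lee_fin (perm_sgmean _ _ _ perm).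
have dimV : dim 'rV[R]_r = r by rewrite dim_matrix; lia.
have -> : t%:R `^ ((r%:R - d%:R) / 2) = Num.sqrt t%:R ^+ (r - d) :> R.
  rewrite -natrB 1?ltnW // mulrC powRrM powR12_sqrt ?ler0n //.
  by rewrite powR_mulrn ?sqrtr_ge0.
have t0 : 0 < Num.sqrt t%:R ^+ (r - d) :> R.
  by rewrite exprn_gt0 // sqrtr_gt0 ltr0n.
(* Condition on the vectors outside the bases: their sum [y] translates [q] and turns [x0] into
   [x0 - y]. The induction starts from the zero subspace as [U]. *)
apply: sgmean_cat_le => y; rewrite ler_pdivlMr //.
have := quadric_bound d Bs U 0 (fun x => q (x + y)) (x0 - y) Bbasis.
rewrite Bsz dimv0 dimV subn0 => /(_ ht hdvd (sub0v _)).
rewrite addn0 => /(_ dimU (quadratic_fun_shift _ y qquad)) bound.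
apply: le_trans (bound _ _).
- rewrite le_eqVlt; apply/orP; left; apply/eqP; congr (_ * _).
  by apply: eq_sgmean => x; rewrite /A opprB addrA.
- by move=> u x; rewrite memv0 => /eqP ->; rewrite addr0.
- exists (x1 - y); last by rewrite subrK.
  by move: Wx1; rewrite WE /= opprB addrA subrK.
Qed.
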